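(* Let $X=(X,d)$ be an ultrametric Polish space whose diameter is nontrivially unbounded. Then there is a map $\psi$ from $\mathscr P(\omega)$ into the clopen subsets of $X$ such that for all $a,b\subseteq\omega$: (1) if $a\subseteq^* b$ then $\psi(a)\le_{\mathsf L(d)}\psi(b)$; (2) if $\psi(a)\le_{\mathsf{Lip}(d)}\psi(b)$ then $a\subseteq^* b$. In particular, $(\mathscr P(\omega),\subseteq^* )$ embeds into both the $\mathsf{Lip}(d)$-hierarchy and the $\mathsf L(d)$-hierarchy on clopen subsets of $X$.
   Context: An ultrametric Polish space is a separable metric space $(X,d)$ with $d$ a complete ultrametric, topologized by $d$. A point $x$ is $\varepsilon$-isolated if $\{y: d(x,y)<\varepsilon\}=\{x\}$. The diameter of $X$ is nontrivially unbounded if for every $k\in\omega$ and every $\varepsilon>0$ there are $x,y\in X$ with $d(x,y)>k$ such that neither $x$ nor $y$ is $\varepsilon$-isolated. $a\subseteq^*b$ means $a\setminus b$ is finite. $\mathsf L(d)$ is the set of nonexpansive maps $X\to X$ ($d(f(x),f(y))\le d(x,y)$), $\mathsf{Lip}(d)$ the set of maps $X\to X$ Lipschitz with some constant. For a set $\mathcal F$ of self-maps, $A\le_{\mathcal F}B$ iff $A=f^{-1}(B)$ for some $f\in\mathcal F$; the $\mathcal F$-hierarchy on a class $\Gamma$ is the quotient of $(\Gamma,\le_{\mathcal F})$ by the induced equivalence. *)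

(* Defs.v *)
From mathcomp Require Import all_boot all_order all_algebra.
From mathcomp Require Import boolp classical_sets functions cardinality reals.
From mathcomp Require Import topology.

Set Implicit Arguments.
Unset Strict Implicit.
Unset Printing Implicit Defensive.

Import Order.TTheory GRing.Theory Num.Theory.

Local Open Scope classical_set_scope.
Local Open Scope ring_scope.

Section UltrametricPolish.
Context {R : realType} (X : metricType R).

Definition ultrametric : Prop :=
  forall x y z : X, mdist x z <= Num.max (mdist x y) (mdist y z).

Definition separable_space : Prop := exists2 D : set X, countable D & dense D.

(* The library's completeType forces the carrier to be pointed. *)
Definition complete_metric : Prop :=
  forall u : nat -> X, cauchy (u @ \oo) -> exists l : X, u @ \oo --> l.

Definition ultrametric_polish : Prop :=
  [/\ ultrametric, separable_space & complete_metric].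

Definition isolated_at (eps : R) (x : X) : Prop :=
  [set y | mdist x y < eps] = [set x].

Definition nontrivially_unbounded : Prop :=
  forall (k : nat) (eps : R), 0 < eps ->
    exists x y : X,
      [/\ k%:R < mdist x y, ~ isolated_at eps x & ~ isolated_at eps y].

Definition nonexpansive_maps : set (X -> X) :=
  [set f | forall x y, mdist (f x) (f y) <= mdist x y].

Definition lipschitz_maps : set (X -> X) :=
  [set f | exists L : R, forall x y, mdist (f x) (f y) <= L * mdist x y].

End UltrametricPolish.

Arguments nonexpansive_maps {R} X _.
Arguments lipschitz_maps {R} X _.

Section Hierarchy.
Context {T : Type} (F : set (T -> T)).

Definition reducible (A B : set T) : Prop :=
  exists2 f : T -> T, F f & A = f @^-1` B.

Definition bireducible (A B : set T) : Prop :=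
  reducible A B /\ reducible B A.

Definition degree (Gamma : set (set T)) (A : set T) : set (set T) :=
  [set B | Gamma B /\ bireducible A B].

(* The F-hierarchy on Gamma: the set of bireducibility classes of Gamma,
   ordered by degree_le. *)
Definition hierarchy (Gamma : set (set T)) : set (set (set T)) :=
  [set degree Gamma A | A in Gamma].

(* When F contains the identity and is closed under composition, this does not
   depend on the representatives. *)
Definition degree_le (C D : set (set T)) : Prop :=
  exists A B : set T, [/\ C A, D B & reducible A B].

End Hierarchy.

Definition almost_subset (a b : set nat) : Prop := finite_set (a `\` b).

(* Embedding of the quasi-order (S, leS) into (Q, leT) with Q a subset of T. *)
Definition embeds_into {S T : Type} (leS : S -> S -> Prop)
    (Q : set T) (leT : T -> T -> Prop) : Prop :=
  exists phi : S -> T, (forall a, Q (phi a)) /\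
    (forall a b, leS a b <-> leT (phi a) (phi b)).

(* Main.v *)
Require Import Defs.
From mathcomp Require Import all_boot all_order all_algebra.
From mathcomp Require Import boolp classical_sets functions cardinality reals.
From mathcomp Require Import topology.

Import Order.TTheory GRing.Theory Num.Theory.

Local Open Scope classical_set_scope.
Local Open Scope ring_scope.

(** Fix a base point [p] and pairs [(x n, y n)] such that the distances
    [r n = d(p, x n)] grow, and the distances [s n = d(x n, y n) > 0] shrink,
    faster than any geometric sequence. For [a] a set of indices, let [Psi a] be
    the union over [n] in [a] of the open balls [B n] of centre [x n] and radius
    [s n], none of which contains any [y m].

    If [f] reduces [Psi a] to [Psi b] and is Lipschitz, then for a large index
    [n] in [a] but not in [b] the pair [(x n, y n)] must be sent to a pair
    separated by some [B m] with [m] in [b]; [m < n] would expand the pair too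
    much, and [m > n] would move [x n] too far away from [f p].

    Conversely, if [a] is contained in [b], moving each ball [B n] with [n] in
    [b] but not in [a] to [y n] is a nonexpansive reduction. Moreover [Psi a]
    reduces to [Psi] of a tail of [a] starting at some [m] in [a], by collapsing
    the ball of centre [p] and radius [r m] onto the pair [{x m, y m}]. Finally,
    coding subsets of the naturals on the odd indices and keeping all even
    indices makes every tail of every code nonempty. *)

(** * Ultrametric inequalities and far non-isolated points *)

Section Ultrametric.
Context {R : realType} {X : metricType R} (um : ultrametric X).
Implicit Types (x y z : X) (e : R).

Lemma ultrametric_lt x y z e : mdist x y < e -> mdist y z < e -> mdist x z < e.
Proof.
by move=> xy yz; apply: le_lt_trans (um x y z) _; rewrite gt_max xy yz.
Qed.

Lemma ultrametric_le x y z e :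
  mdist x y <= e -> mdist y z <= e -> mdist x z <= e.
Proof. by move=> xy yz; apply: le_trans (um x y z) _; rewrite ge_max xy yz. Qed.

Lemma ultrametric_isosceles x y z :
  mdist x y < mdist y z -> mdist x z = mdist y z.
Proof.
move=> h; apply: le_anti; rewrite (ultrametric_le _ _ _ _ (ltW h)) //=.
rewrite leNgt; apply/negP => h1.
have : mdist y z < mdist y z.
  by apply: (@ultrametric_lt _ x); rewrite // metric_sym.
by rewrite ltxx.
Qed.

(** The hypothesis, used for [(z, w)] and for [(w, z)], bounds every step of the chain [f z], [z],
    [w], [f w] by [mdist z w]. *)
Lemma nonexpansive_of_displacement (f : X -> X) :
  (forall z w, f z = f w \/ mdist (f z) z <= mdist z w) -> nonexpansive_maps X f.
Proof.
move=> H z w; case: (H z w) => [->|hz]; first by rewrite mdistxx mdist_ge0.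
case: (H w z) => [->|hw]; first by rewrite mdistxx mdist_ge0.
apply: (@ultrametric_le _ z) => //; apply: (@ultrametric_le _ w) => //.
by rewrite metric_sym (metric_sym z).
Qed.

(** Two points more than [K] apart cannot both lie within [K] of [p]; the farther one is not
    isolated, which yields its close companion. *)
Lemma nontrivially_unbounded_far (p : X) : nontrivially_unbounded X ->
  forall K e, 0 < e ->
  exists xy : X * X, K < mdist p xy.1 /\ 0 < mdist xy.1 xy.2 < e.
Proof.
move=> unb K e e0.
have [x [y [xy nx ny]]] := unb (Num.Def.trunc K).+1 e e0.
have {xy} Kxy : K < mdist x y by apply: lt_trans xy; exact: truncnS_gt.
have nonisolated z : ~ isolated_at e z -> exists w, 0 < mdist z w < e.
  move=> nz; apply: contrapT => H; apply: nz; apply/seteqP; split => w /=.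
    move=> zw; apply: contrapT => wz; apply: H; exists w.
    by rewrite zw mdist_gt0 andbT; apply/eqP => zw'; apply: wz.
  by move=> ->; rewrite mdistxx.
case: (ltP K (mdist p x)) => [Kx|xK].
  by have [w hw] := nonisolated _ nx; exists (x, w).
have [w hw] := nonisolated _ ny; exists (y, w); split => //=.
rewrite ltNge; apply/negP => yK; move: Kxy; rewrite ltNge => /negP; apply.
by apply: (@ultrametric_le _ p) => //; rewrite metric_sym.
Qed.

End Ultrametric.

(** * Existence of fast pairs *)

Section FastPairs.
Context {R : realType} {X : metricType R}.

(** The factor [n.+1] eventually exceeds any Lipschitz constant, and being at least 1 it also gives
    monotonicity. The threshold 1 keeps every [s n] below every [r m]. *)
Record fast_pairs (p : X) (x y : nat -> X) : Prop := FastPairs {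
  fast_r0 : 1 < mdist p (x 0%N);
  fast_s0 : mdist (x 0%N) (y 0%N) < 1;
  fast_s_gt0 : forall n, 0 < mdist (x n) (y n);
  fast_r : forall n, n.+1%:R * mdist p (x n) < mdist p (x n.+1);
  fast_s : forall n, n.+1%:R * mdist (x n.+1) (y n.+1) < mdist (x n) (y n) }.

Lemma exists_fast_pairs : ultrametric X -> nontrivially_unbounded X ->
  exists p x y, fast_pairs p x y.
Proof.
move=> um unb; have [p _] := unb 0%N 1 ltr01.
(* The guard makes the statement total, so that choice gives a function to iterate; [(p, p)] is a
   dummy value. *)
have H (Ke : R * R) : exists xy : X * X, 0 < Ke.2 ->
    Ke.1 < mdist p xy.1 /\ 0 < mdist xy.1 xy.2 < Ke.2.
  have [e0|_] := ltP 0 Ke.2; last by exists (p, p).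
  by have [xy ?] := nontrivially_unbounded_far um p unb Ke.1 Ke.2 e0; exists xy.
have [next nextP] := choice H.
pose q n := iteri n (fun n xy =>
  next (n.+1%:R * mdist p xy.1, mdist xy.1 xy.2 / n.+1%:R)) (next (1, 1)).
have q0 := nextP (1, 1) ltr01.
have qstep n : 0 < mdist (q n).1 (q n).2 ->
    n.+1%:R * mdist p (q n).1 < mdist p (q n.+1).1 /\
    0 < mdist (q n.+1).1 (q n.+1).2 < mdist (q n).1 (q n).2 / n.+1%:R.
  move=> qn; exact: (nextP (n.+1%:R * mdist p (q n).1,
    mdist (q n).1 (q n).2 / n.+1%:R) (divr_gt0 qn (ltr0Sn _ n))).
have qgt0 n : 0 < mdist (q n).1 (q n).2.
  by elim: n => [|n /qstep[_ /andP[]]//]; case: q0 => _ /andP[].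
have qS n := qstep n (qgt0 n).
exists p, (fun n => (q n).1), (fun n => (q n).2); split => //.
- by case: q0.
- by case: q0 => _ /andP[].
- by move=> n; case: (qS n).
- move=> n; case: (qS n) => _ /andP[_].
  by rewrite ltr_pdivlMr // mulrC.
Qed.

Context (um : ultrametric X) (p : X) (x y : nat -> X) (fp : fast_pairs p x y).

Let r n := mdist p (x n).
Let s n := mdist (x n) (y n).
Let B n : set X := [set z | mdist (x n) z < s n].

Definition ball_union (a : set nat) : set X := \bigcup_(n in a) B n.

(** * Growth of [r], decay of [s], separation of the centres *)

Lemma fast_r_ge1 n : 1 <= r n.
Proof.
elim: n => [|n IH]; first exact: ltW (fast_r0 _ _ _ fp).
apply: ltW; apply: le_lt_trans (fast_r _ _ _ fp n); apply: le_trans IH _.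
by rewrite ler_peMl ?ler1n ?mdist_ge0.
Qed.

Lemma fast_r_ge_nat n : n%:R <= r n.
Proof.
case: n => [|n]; first exact: mdist_ge0.
apply: ltW; apply: le_lt_trans (fast_r _ _ _ fp n).
by rewrite ler_peMr // fast_r_ge1.
Qed.

Lemma fast_r_ltS n : r n < r n.+1.
Proof.
apply: le_lt_trans (fast_r _ _ _ fp n).
by rewrite ler_peMl ?ler1n // (le_trans ler01) // fast_r_ge1.
Qed.

Lemma fast_r_lt m n : (r m < r n) = (m < n)%N.
Proof. by rewrite (leW_mono (le_mono (homo_ltn lt_trans fast_r_ltS))). Qed.

Lemma fast_r_ltM n m : (n < m)%N -> n%:R * r n < r m.
Proof.
move=> nm; apply: le_lt_trans (_ : n.+1%:R * r n < _).
  by rewrite ler_wpM2r ?ler_nat // mdist_ge0.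
apply: lt_le_trans (fast_r _ _ _ fp n) _.
by move: nm; rewrite leq_eqVlt => /predU1P[<-//|]; rewrite -fast_r_lt => /ltW.
Qed.

Lemma fast_s_leS n : s n.+1 <= s n.
Proof.
apply: ltW; apply: le_lt_trans (fast_s _ _ _ fp n).
by rewrite ler_peMl ?ler1n ?mdist_ge0.
Qed.

Lemma fast_s_le m n : (m <= n)%N -> s n <= s m.
Proof.
by elim: n m => [|n IH] m; rewrite leq_eqVlt => /predU1P[->//|];
  rewrite // ltnS => /IH; apply: le_trans; exact: fast_s_leS.
Qed.

Lemma fast_s_lt1 n : s n < 1.
Proof. by apply: le_lt_trans (fast_s0 _ _ _ fp); exact: fast_s_le. Qed.

Lemma fast_s_ltM m n : (m < n)%N -> n%:R * s n < s m.
Proof.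
case: n => // n; rewrite ltnS => mn.
by apply: lt_le_trans (fast_s _ _ _ fp n) _; exact: fast_s_le.
Qed.

Lemma fast_dist_ge1 m n : m != n -> 1 <= mdist (x m) (x n).
Proof.
wlog mn : m n / (m < n)%N => [H|_].
  by rewrite neq_ltn => /orP[mn|nm]; [|rewrite metric_sym]; apply: H;
    rewrite // ltn_eqF.
have := mn; rewrite -fast_r_lt /r (metric_sym p (x m)) => h.
by rewrite (ultrametric_isosceles um _ _ _ h) fast_r_ge1.
Qed.

Lemma fast_near_inj z m n :
  mdist (x m) z < 1 -> mdist (x n) z < 1 -> m = n.
Proof.
move=> mz nz; apply/eqP; apply/negP => /negP /fast_dist_ge1.
rewrite leNgt => /negP; apply; apply: (ultrametric_lt um) mz _.
by rewrite metric_sym.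
Qed.

(** * The balls [B n] and their clopen unions *)

Lemma ball_lt1 n z : B n z -> mdist (x n) z < 1.
Proof. by move=> h; apply: lt_trans h (fast_s_lt1 n). Qed.

Lemma ball_center n : B n (x n).
Proof. by rewrite /B /= mdistxx; exact: (fast_s_gt0 _ _ _ fp). Qed.

(** As [s n < 1 <= r n], the isosceles law fixes the distance to [p]; the index of a ball can thus
    be read off from that distance. *)
Lemma ball_dist n z : B n z -> mdist p z = r n.
Proof.
move=> /ball_lt1 h; rewrite metric_sym (@ultrametric_isosceles _ _ um z (x n) p).
  by rewrite metric_sym.
by rewrite metric_sym (lt_le_trans h) // metric_sym fast_r_ge1.
Qed.

Lemma ball_separated n z w : B n z -> ~ B n w -> s n <= mdist z w.
Proof.
by move=> nz nw; rewrite leNgt; apply/negP => zw; apply: nw;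
  apply: (ultrametric_lt um) nz zw.
Qed.

Lemma dist_p_y n : mdist p (y n) = r n.
Proof.
rewrite metric_sym (@ultrametric_isosceles _ _ um (y n) (x n) p).
  by rewrite metric_sym.
by rewrite metric_sym (lt_le_trans (fast_s_lt1 n)) // metric_sym fast_r_ge1.
Qed.

Lemma ball_union_mem a n z : B n z -> ball_union a z <-> a n.
Proof.
move=> nz; split=> [[m am /ball_lt1 mz]|an]; last by exists n.
by rewrite (fast_near_inj z n m) //; exact: ball_lt1.
Qed.

Lemma ball_union_y a n : ~ ball_union a (y n).
Proof.
move=> [m _ h]; have mn := fast_near_inj _ _ _ (ball_lt1 _ _ h) (fast_s_lt1 n).
by move: h; rewrite /B /= mn ltxx.
Qed.

Lemma clopen_ball_union a : clopen (ball_union a).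
Proof.
split.
  rewrite openE => z [n an nz].
  rewrite /interior -metricType_numDomainType.nbhs_nbhs_mdist.
  exists (s n); first exact: (fast_s_gt0 _ _ _ fp).
  by move=> w /= zw; exists n => //; apply: (ultrametric_lt um) nz zw.
rewrite -openC openE => z nz.
rewrite /interior -metricType_numDomainType.nbhs_nbhs_mdist.
(* A ball [B n] meeting the unit ball around [z] has [n <= r n <= max 1 (mdist p z)], hence [n <= N]
   and [s N <= s n], whereas [z], lying outside [B n], is at least [s n] away from it. *)
pose N := (Num.Def.trunc (Num.max 1 (mdist p z))).+1.
exists (s N); first exact: (fast_s_gt0 _ _ _ fp).
move=> w /= zw [n an nw].
have zw1 := ltW (lt_trans zw (fast_s_lt1 N)).
have : s n <= mdist w z by apply: ball_separated nw _ => nz'; apply: nz; exists n.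
apply/negP; rewrite -ltNge metric_sym; apply: lt_le_trans zw _; apply: fast_s_le.
rewrite -(@ler_nat R); apply: le_trans (fast_r_ge_nat n) _.
rewrite -(ball_dist _ _ nw); apply: le_trans (ltW (truncnS_gt _)).
apply: le_trans (um p z w) _.
by rewrite ge_max !le_max lexx orbT /= zw1.
Qed.

(** * Reductions between unions of balls *)

Lemma ball_union_sub_reducible a b : a `<=` b ->
  reducible (nonexpansive_maps X) (ball_union a) (ball_union b).
Proof.
move=> ab.
have /choice[f fP] : forall z, exists w,
    (forall n, (b `\` a) n -> B n z -> w = y n) /\
    ((forall n, (b `\` a) n -> ~ B n z) -> w = z).
  move=> z; have [[n bn nz]|H] := pselect (exists2 n, (b `\` a) n & B n z).
    exists (y n); split=> [m _ mz|/(_ n bn)//].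
    by rewrite (fast_near_inj z n m) //; exact: ball_lt1.
  by exists z; split=> // n bn nz; case: H; exists n.
exists f.
  apply: nonexpansive_of_displacement => // z w.
  have [[n bn nz]|H] := pselect (exists2 n, (b `\` a) n & B n z); last first.
    right; have -> : f z = z by apply: (fP z).2 => n bn nz; apply: H; exists n.
    by rewrite mdistxx mdist_ge0.
  rewrite ((fP z).1 n bn nz).
  have [nw|nw] := pselect (B n w); first by left; rewrite ((fP w).1 n bn nw).
  (* A point of [B n] moves by at most [s n], and every [w] outside [B n] is at least that far from
     it. *)
  right; apply: le_trans (ball_separated _ _ _ nz nw).
  by apply: (@ultrametric_le _ _ um _ (x n)); [rewrite metric_sym|exact: ltW].
apply/seteqP; split => z /=.
  move=> az; have -> : f z = z.
    by apply: (fP z).2 => n [_ an] nz; apply: an; apply/(ball_union_mem a n z nz).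
  by case: az => n an nz; exists n => //; exact: ab.
have [[n bn nz]|H] := pselect (exists2 n, (b `\` a) n & B n z).
  by rewrite ((fP z).1 n bn nz) => /ball_union_y.
rewrite ((fP z).2 (fun n bn nz => H (ex_intro2 _ _ n bn nz))) => -[n bn nz].
by exists n => //; apply: contrapT => an; apply: H; exists n.
Qed.

Lemma ball_union_tail_reducible a m : a m ->
  reducible (nonexpansive_maps X) (ball_union a)
    (ball_union (a `&` [set n | (m <= n)%N])).
Proof.
move=> am; set a' := _ `&` _.
pose g z := if `[< ball_union a z >] then x m else y m.
pose f z := if mdist p z < r m then g z else z.
have dg z : mdist p (g z) = r m by rewrite /g; case: ifP => _ //; exact: dist_p_y.
(* Only balls of index [n < m] come closer to [p] than [r m], and their radii are at least [s m],
   the distance between the two values of [g]. *)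
have sep z w : mdist p z < r m -> ball_union a z -> ~ ball_union a w ->
    s m <= mdist z w.
  move=> zm [n an nz] aw; apply: (@le_trans _ _ (s n)); last first.
    by apply: ball_separated nz _ => nw; apply: aw; exists n.
  by apply: fast_s_le; rewrite ltnW // -fast_r_lt -(ball_dist _ _ nz).
(* Here [mdist z w = mdist p w], which is at least [r m], the distance from [p] to [g z]. *)
have mixed z w : mdist p z < r m -> r m <= mdist p w ->
    mdist (g z) w <= mdist z w.
  move=> zm mw; rewrite (@ultrametric_isosceles _ _ um z p w).
    by apply: (@ultrametric_le _ _ um _ p) => //; rewrite metric_sym dg.
  by rewrite metric_sym (lt_le_trans zm).
exists f.
  move=> z w; rewrite /f.
  have [zm|mz] := ltP (mdist p z); have [wm|mw] := ltP (mdist p w) => //.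
  - rewrite /g; case: asboolP => az; case: asboolP => aw;
      rewrite ?mdistxx ?mdist_ge0 //; first exact: sep.
    by rewrite metric_sym (metric_sym z); exact: sep.
  - exact: mixed.
  - by rewrite metric_sym (metric_sym z); exact: mixed.
apply/seteqP; rewrite /f; split=> z /=; case: ltP => zm.
- move=> az; rewrite /g asboolT //; exists m; last exact: ball_center.
  by split => //=.
- move=> [n an nz]; exists n => //; split => //=.
  by rewrite leqNgt -fast_r_lt -leNgt -(ball_dist _ _ nz).
- by rewrite /g; case: asboolP => // _ /ball_union_y.
- by move=> [n [an _] nz]; exists n.
Qed.

Lemma ball_union_lipschitz_reducible a b :
  reducible (lipschitz_maps X) (ball_union a) (ball_union b) ->
  exists N, forall n, (N <= n)%N -> a n -> b n.
Proof.
move=> [f [L fL] fab].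
pose D := mdist (f p) p.
(* From here on [n] dominates both the Lipschitz constant and the displacement of [p]. *)
exists (Num.Def.trunc (Num.max L D)).+1 => n Nn an; apply: contrapT => nbn.
have : Num.max L D <= n%:R.
  by apply: ltW; apply: lt_le_trans (truncnS_gt _) _; rewrite ler_nat.
rewrite ge_max => /andP[Ln Dn].
have [m bm mfx] : ball_union b (f (x n)).
  have : ball_union a (x n) by exists n => //; exact: ball_center.
  by rewrite fab.
have nfy : ~ B m (f (y n)).
  move=> my; apply: (ball_union_y a n); rewrite fab.
  by exists m.
have [mn|nm|mn] := ltngtP m n; last by apply: nbn; rewrite -mn.
- have := ball_separated _ _ _ mfx nfy; apply/negP; rewrite -ltNge.
  apply: le_lt_trans (fast_s_ltM m n mn); apply: le_trans (fL _ _) _.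
  by rewrite ler_wpM2r ?mdist_ge0.
(* Go from [f (x n)] to [p] through [f p]: the first distance is at most [L * r n], the second is
   [D <= n%:R <= n%:R * r n]. *)
- have : r m <= n%:R * r n.
    rewrite -(ball_dist _ _ mfx) metric_sym.
    apply: (@ultrametric_le _ _ um _ (f p)).
      apply: le_trans (fL _ _) _; rewrite metric_sym.
      by rewrite ler_wpM2r ?mdist_ge0.
    by apply: le_trans Dn _; rewrite ler_peMr // fast_r_ge1.
  by apply/negP; rewrite -ltNge; exact: fast_r_ltM.
Qed.

End FastPairs.

(** * Coding inclusion modulo finite sets as inclusion of tails *)

Definition odd_code (a : set nat) : set nat := [set n | odd n -> a n./2].

Lemma odd_code_almost_subset a b : almost_subset a b <->
  exists N, forall n, (N <= n)%N -> odd_code a n -> odd_code b n.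
Proof.
split.
  (* Doubling the successor of the maximum makes [n./2] exceed every element of the finite
     difference. *)
  move=> /finite_seqP[t abt]; exists (\max_(i <- t) i).+1.*2 => n Nn an on.
  apply: contrapT => nb; have : (a `\` b) n./2 by split=> //; exact: an.
  rewrite abt /= => nt; have := @leq_bigmax_seq _ t xpredT id _ nt isT.
  by rewrite leqNgt => /negP; apply; rewrite -[_.+1]doubleK half_leq.
move=> [N HN]; apply: (@sub_finite_set _ _ `I_N); last exact: finite_II.
move=> k [ak nbk] /=; rewrite ltnNge; apply/negP => Nk; apply: nbk.
have /HN : (N <= k.*2.+1)%N by rewrite (leq_trans Nk) // -addnn -addnS leq_addr.
by rewrite /odd_code /= odd_double uphalf_double; apply.
Qed.

(** * From reducibility of sets to the order on degrees *)

Section Degrees.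
Context {T : Type} {F : set (T -> T)} (F_id : F id)
  (F_comp : forall f g, F f -> F g -> F (g \o f)).

Lemma reducible_refl A : reducible F A A.
Proof. by exists id. Qed.

Lemma reducible_trans A B C :
  reducible F A B -> reducible F B C -> reducible F A C.
Proof.
by move=> [f Ff ->] [g Fg ->]; exists (g \o f); [exact: F_comp|].
Qed.

(** Bireducibility and transitivity carry a reduction between arbitrary representatives over to [A]
    and [B]. *)
Lemma degree_le_reducible (Gamma : set (set T)) A B : Gamma A -> Gamma B ->
  degree_le F (degree F Gamma A) (degree F Gamma B) <-> reducible F A B.
Proof.
move=> GA GB; split.
  move=> [A' [B' [[_ [AA' _]] [_ [_ B'B]] A'B']]].
  by apply: (reducible_trans _ _ _ AA'); apply: (reducible_trans _ _ _ A'B').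
move=> AB; exists A, B; split => //; split => //; split; exact: reducible_refl.
Qed.

Lemma embeds_into_hierarchy {S : Type} (leS : S -> S -> Prop)
    (Gamma : set (set T)) (psi : S -> set T) :
  (forall a, Gamma (psi a)) ->
  (forall a b, leS a b <-> reducible F (psi a) (psi b)) ->
  embeds_into leS (hierarchy F Gamma) (degree_le F).
Proof.
move=> Gpsi H; exists (fun a => degree F Gamma (psi a)); split.
  by move=> a; exists (psi a).
by move=> a b; rewrite H degree_le_reducible.
Qed.

End Degrees.

Section Maps.
Context {R : realType} {X : metricType R}.

Lemma nonexpansive_comp (f g : X -> X) :
  nonexpansive_maps X f -> nonexpansive_maps X g -> nonexpansive_maps X (g \o f).
Proof. by move=> hf hg u v; apply: le_trans (hg _ _) (hf _ _). Qed.

Lemma nonexpansive_lipschitz : nonexpansive_maps X `<=` lipschitz_maps X.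
Proof. by move=> f hf; exists 1 => u v; rewrite mul1r. Qed.

Lemma lipschitz_comp (f g : X -> X) :
  lipschitz_maps X f -> lipschitz_maps X g -> lipschitz_maps X (g \o f).
Proof.
(* The constant [M] may be negative; its absolute value makes the multiplication monotone. *)
move=> [L hf] [M hg]; exists (`|M| * L) => u v; apply: le_trans (hg _ _) _.
rewrite -mulrA; apply: (@le_trans _ _ (`|M| * mdist (f u) (f v))).
  by rewrite ler_wpM2r ?mdist_ge0 ?ler_norm.
by rewrite ler_wpM2l.
Qed.

End Maps.

Theorem theorem3p14 (R : realType) (X : metricType R)
    (polishX : ultrametric_polish X)
    (unboundedX : nontrivially_unbounded X) :
  (exists psi : set nat -> set X,
    [/\ forall a : set nat, clopen (psi a),
        forall a b : set nat, almost_subset a b ->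
          reducible (nonexpansive_maps X) (psi a) (psi b) &
        forall a b : set nat,
          reducible (lipschitz_maps X) (psi a) (psi b) -> almost_subset a b])
  /\ embeds_into almost_subset
       (hierarchy (lipschitz_maps X) (@clopen X))
       (degree_le (lipschitz_maps X))
  /\ embeds_into almost_subset
       (hierarchy (nonexpansive_maps X) (@clopen X))
       (degree_le (nonexpansive_maps X)).
Proof.
have [um _ _] := polishX.
have [p [x [y fp]]] := exists_fast_pairs um unboundedX.
pose psi a := ball_union x y (odd_code a).
have psi_clopen a : clopen (psi a) by exact: (clopen_ball_union um _ _ _ fp).
have psi_le a b : almost_subset a b ->
    reducible (nonexpansive_maps X) (psi a) (psi b).
  move=> /odd_code_almost_subset[N HN].
  (* An even index belongs to every code, so the tail may start at [N.*2]; from there on the code of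
     [a] lies in that of [b]. *)
  have aN : odd_code a N.*2 by rewrite /odd_code /= odd_double.
  apply: (reducible_trans nonexpansive_comp).
    exact: (ball_union_tail_reducible um _ _ _ fp _ _ aN).
  apply: (ball_union_sub_reducible um _ _ _ fp) => n [an Nn].
  by apply: HN an; apply: leq_trans Nn; rewrite -addnn leq_addr.
have psi_ge a b : reducible (lipschitz_maps X) (psi a) (psi b) ->
    almost_subset a b.
  move=> h; apply/odd_code_almost_subset.
  exact: (ball_union_lipschitz_reducible um _ _ _ fp _ _ h).
(* This transfer completes both equivalences: it follows [psi_le] for Lipschitz maps and precedes
   [psi_ge] for nonexpansive ones. *)
have lip_red A B : reducible (nonexpansive_maps X) A B ->
    reducible (lipschitz_maps X) A B.
  by move=> [f hf ->]; exists f => //; exact: nonexpansive_lipschitz.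
have id_nonexp : nonexpansive_maps X id by move=> u v.
split; first by exists psi.
split.
  apply: (embeds_into_hierarchy (nonexpansive_lipschitz _ id_nonexp)
    lipschitz_comp _ _ psi) => // a b.
  by split=> [/psi_le/lip_red|/psi_ge].
apply: (embeds_into_hierarchy id_nonexp nonexpansive_comp _ _ psi) => // a b.
by split=> [/psi_le|/lip_red/psi_ge].
Qed.
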